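(* Consider a D2-brane in flat space with two transverse scalars $X(x^1,x^2)$, $Y(x^1,x^2)$, a static worldvolume magnetic field $B(x^1,x^2)$ and no electric field, and restrict to finite-energy configurations whose magnetic field vanishes at infinity. Suppose the scalars satisfy the BPS vortex condition, for one choice of sign, $$\partial_iX=\pm\epsilon_{ij}\partial_jY,\qquad i=1,2 .$$ Then, in units of the brane tension, the stress tensor is $$\Pi^i_{\ j}=\delta^i_{\ j}\,\frac{\sqrt{\det\hat{M}}-1}{\sqrt{\det\hat{M}}},\qquad \det\hat{M}=1+\frac{B^2}{\left(1+(\partial Y)^2\right)^2}.$$ For $B=0$ (the usual BPS vortices) it is exactly zero. Otherwise $\Pi^i_{\ j}\ge 0$ and its integral over the plane cannot vanish. Consequently there are no vortex solutions satisfying $\partial_iX=\pm\epsilon_{ij}\partial_jY$ with $B\neq0$: the Abelian BPS vortices disappear when a magnetic field is turned on on the D2-brane.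
   Context: $(\partial Y)^2=\partial_iY\,\partial_iY$ and $\epsilon_{ij}$ is the antisymmetric symbol with $\epsilon_{12}=1$. The induced spatial metric is $g_{ij}=\delta_{ij}+\partial_iX\partial_jX+\partial_iY\partial_jY$, which under the BPS vortex condition equals $(1+(\partial Y)^2)\delta_{ij}$. The magnetic field strength (with $2\pi\alpha'$ absorbed) is $F_{ij}=B\epsilon_{ij}$, and $\hat M_i^{\ j}=\delta_i^{\ j}+F_{ik}g^{kj}$ with $g^{kj}$ the inverse of $g_{ij}$. In units of the tension and with $e^{-\phi}=1$ for the dilaton $\phi$, the Dirac-Born-Infeld energy density is $\mathcal{E}_{DBI}=\sqrt{\det(g_{ij})+B^2}$, which equals $\sqrt{(1+(\partial Y)^2)^2+B^2}$ under the BPS vortex condition. The Ramond-Ramond potential along the brane is $C^{(3)}_{012}=e^{-\phi}$, so that it subtracts the energy density of the trivial configuration and the total energy density is $\mathcal{E}=\mathcal{E}_{DBI}-1$. The stress tensor is $$\Pi^i_{\ j}=\frac{\partial\mathcal{E}}{\partial(\partial_iX)}\partial_jX+\frac{\partial\mathcal{E}}{\partial(\partial_iY)}\partial_jY+\frac{\partial\mathcal{E}}{\partial B}\,B\,\delta^i_{\ j}-\delta^i_{\ j}\,\mathcal{E},$$ so that $-\int\partial_i\xi^j\,\Pi^i_{\ j}\,d^2x$ is the first-order change of the energy under a deformation $x^i\to x^i+\xi^i$ linear in the coordinates. A soliton (finite-energy static solution minimizing the energy, with fields decaying fast enough at infinity) must satisfy $\int\Pi^i_{\ j}\,d^2x=0$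 for all $i,j$; this is the constraint used to exclude solutions. *)

(* Defs.v *)
From HB Require Import structures.
From mathcomp Require Import all_boot all_order all_algebra.
From mathcomp Require Import all_classical all_reals all_analysis.

Set Implicit Arguments.
Unset Strict Implicit.
Unset Printing Implicit Defensive.

Import Order.TTheory GRing.Theory Num.Theory.
Import numFieldNormedType.Exports.

Local Open Scope classical_set_scope.
Local Open Scope ring_scope.

(* The indices 1, 2 of the plane are 0, 1 : 'I_2, and the plane is R * R with
   the product Lebesgue measure. *)

Notation area R := (@lebesgue_measure R \x @lebesgue_measure R)%E.

Definition basis_vec (R : realType) (i : 'I_2) : R * R :=
  if i == 0 then (1, 0) else (0, 1).

Definition partial (R : realType) (i : 'I_2) (f : R * R -> R) (x : R * R) : R :=
  'D_(basis_vec R i) f x.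

Definition grad (R : realType) (f : R * R -> R) (x : R * R) : 'rV[R]_2 :=
  \row_i partial i f x.

Definition eps (R : realType) : 'M[R]_2 :=
  \matrix_(i, j) (((i == 0) && (j == 1))%:R - ((i == 1) && (j == 0))%:R).

(* The next definitions are functions of the values p = dX, q = dY, b = B at
   a point, so that the energy density can be differentiated with respect to
   these variables. *)

Definition metric (R : realType) (p q : 'rV[R]_2) : 'M[R]_2 :=
  1%:M + p^T *m p + q^T *m q.

Definition Mhat (R : realType) (p q : 'rV[R]_2) (b : R) : 'M[R]_2 :=
  1%:M + (b *: eps R) *m invmx (metric p q).

Definition energy_DBI (R : realType) (p q : 'rV[R]_2) (b : R) : R :=
  Num.sqrt (\det (metric p q) + b ^+ 2).

(* The subtracted 1 is the Ramond-Ramond potential C_012 = e^{-phi} = 1. *)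
Definition energy_density (R : realType) (p q : 'rV[R]_2) (b : R) : R :=
  energy_DBI p q b - 1.

Definition stress_density (R : realType) (p q : 'rV[R]_2) (b : R)
    (i j : 'I_2) : R :=
  'D_(delta_mx 0 i) (fun p' : 'rV[R]_2 => energy_density p' q b) p * p 0 j
  + 'D_(delta_mx 0 i) (fun q' : 'rV[R]_2 => energy_density p q' b) q * q 0 j
  + derive1 (fun b' : R => energy_density p q b') b * b * (i == j)%:R
  - (i == j)%:R * energy_density p q b.

(* [cores] is a set where the fields may be singular (vortex cores, sources);
   it is empty for fields that are regular on the whole plane. The values of
   the fields on [cores] are irrelevant. *)
Record configuration (R : realType) := Configuration {
  cores : set (R * R);
  scalarX : R * R -> R;
  scalarY : R * R -> R;
  fieldB : R * R -> R
}.

Definition regular_fields (R : realType) (c : configuration R) : Prop :=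
  [/\ closed (cores c) /\ (area R).-negligible (cores c),
      forall x, ~ cores c x ->
        differentiable (scalarX c) x /\ differentiable (scalarY c) x,
      forall i x, ~ cores c x ->
        {for x, continuous (partial i (scalarX c))} /\
        {for x, continuous (partial i (scalarY c))}
    & forall x, ~ cores c x -> {for x, continuous (fieldB c)}].

Definition config_Mhat (R : realType) (c : configuration R) (x : R * R) :
    'M[R]_2 :=
  Mhat (grad (scalarX c) x) (grad (scalarY c) x) (fieldB c x).

Definition config_density (R : realType) (c : configuration R) (x : R * R) : R :=
  energy_density (grad (scalarX c) x) (grad (scalarY c) x) (fieldB c x).

Definition stress (R : realType) (c : configuration R) (x : R * R)
    (i j : 'I_2) : R :=
  stress_density (grad (scalarX c) x) (grad (scalarY c) x) (fieldB c x) i j.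

Definition energy (R : realType) (c : configuration R) : \bar R :=
  (\int[area R]_(x in ~` cores c) (config_density c x)%:E)%E.

Definition vanishing_at_infinity (R : realType) (c : configuration R) : Prop :=
  forall e : R, 0 < e -> exists r : R, forall x : R * R,
    ~ cores c x -> r < `|x| -> `|fieldB c x| < e.

Definition finite_energy_configuration (R : realType) (c : configuration R) :
    Prop :=
  [/\ regular_fields c, (energy c < +oo)%E & vanishing_at_infinity c].

(* The sign is + for [sgn = false] and - for [sgn = true]. *)
Definition bps_vortex (R : realType) (sgn : bool) (c : configuration R) : Prop :=
  forall x, ~ cores c x -> forall i : 'I_2,
    partial i (scalarX c) x =
      (-1) ^+ sgn * \sum_(j < 2) eps R i j * partial j (scalarY c) x.

Definition has_magnetic_field (R : realType) (c : configuration R) : Prop :=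
  exists x, ~ cores c x /\ fieldB c x <> 0.

(* x^j + xi^j with xi^j = x^i A_i^j, so that A i j is d_i xi^j. *)
Definition linear_map (R : realType) (A : 'M[R]_2) (x : R * R) : R * R :=
  (x.1 + (x.1 * A 0 0 + x.2 * A 1 0), x.2 + (x.1 * A 0 1 + x.2 * A 1 1)).

(* The fields pulled back along the linear map: the scalars are composed with
   it, and B, being the component of a two-form, also gets its Jacobian. This
   is the term (dE/dB) B delta^i_j of the stress tensor, and it preserves the
   magnetic flux. *)
Definition deform (R : realType) (A : 'M[R]_2) (c : configuration R) :
    configuration R :=
  Configuration (linear_map A @^-1` cores c)
    (scalarX c \o linear_map A) (scalarY c \o linear_map A)
    (fun x => \det (1%:M + A) * fieldB c (linear_map A x)).

(* Minimality is only required against linear deformations close to the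
   identity (a class stable under inversion). Nothing else about minimality is
   used, in particular not the equation of motion d_i (dE/dB) = 0, which alone
   would force a field B that vanishes at infinity to be zero. *)
Definition soliton (R : realType) (c : configuration R) : Prop :=
  finite_energy_configuration c /\
  \forall A \near (0 : 'M[R]_2), (energy c <= energy (deform A c))%E.

Definition deformation_constraint (R : realType) (c : configuration R) : Prop :=
  forall i j : 'I_2,
    (\int[area R]_(x in ~` cores c) (stress c x i j)%:E = 0)%E.

(* Main.v *)
Require Import Defs.
From HB Require Import structures.
From mathcomp Require Import all_boot all_order all_algebra.
From mathcomp Require Import all_classical all_reals all_analysis.
From mathcomp Require Import measurable_realfun ring lra.

Set Implicit Arguments.
Unset Strict Implicit.
Unset Printing Implicit Defensive.

Import Order.TTheory GRing.Theory Num.Theory.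
Import numFieldNormedType.Exports.

Local Open Scope classical_set_scope.
Local Open Scope ring_scope.

(* Under the vortex condition the induced metric is m times the identity with
   m = 1 + |dY|^2, which gives the stress tensor in closed form and bounds it
   pointwise by the energy density. A field that is nonzero at one point is
   nonzero on an open set, so the integral of the stress is positive.

   Minimality is refuted directly rather than through the first variation:
   after the change of variables y = l x, the energy of the configuration
   dilated by l is the integral of sqrt ((mu + |dY|^2)^2 + B^2) - mu with
   mu = l^-2. The integrand is nonincreasing in mu, and decreasing where B does
   not vanish, so every l < 1 lowers the energy. *)

(** * Derivatives of the energy density in its three arguments *)

Lemma derive_line (R : realType) (V : normedModType R) (f : V -> R) (a v : V) :
  'D_v f a = derive1 (fun h : R => f (h *: v + a)) 0.
Proof.
by rewrite /derive1 /derive; under [in RHS]eq_fun do rewrite addr0 scale0r add0r.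
Qed.

(** Along each line in a coordinate of [p] or in [b], the radicand of the energy density is a
    quadratic polynomial in the parameter, so this one formula serves for all its derivatives. The
    term in [C] has zero derivative at 0. *)
Lemma derive1_sqrt_quadratic (R : realType) (A B C k : R) : 0 < A ->
  derive1 (fun h : R => Num.sqrt (A + B * h + C * h ^+ 2) - k) 0 =
    B / (2 * Num.sqrt A).
Proof.
move=> A0; rewrite derive1E.
pose g (h : R) : R := A + B * h + C * h ^+ 2.
have g0 : g 0 = A by rewrite /g expr0n /= !mulr0 !addr0.
have dg : is_derive (0 : R) 1 g B.
  apply: is_derive_eq; rewrite /GRing.scale /=; ring.
have ds : is_derive (g 0) 1 (@Num.sqrt R) (2 * Num.sqrt A)^-1.
  by rewrite g0; exact: is_derive1_sqrt.
have dsg := is_derive1_comp ds dg.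
have dk : is_derive (0 : R) 1 ((@Num.sqrt R \o g) - cst k) ((2 * Num.sqrt A)^-1 * B - 0).
  exact: is_deriveB.
by rewrite -[LHS]/('D_1 ((@Num.sqrt R \o g) - cst k) 0) derive_val subr0 mulrC.
Qed.

Lemma det_mx2 (R : comPzRingType) (M : 'M[R]_2) :
  \det M = M 0 0 * M 1 1 - M 0 1 * M 1 0.
Proof.
rewrite (expand_det_row M 0) !big_ord_recl big_ord0 addr0 /cofactor !det_mx11 !mxE /=.
rewrite !expr0 !mul1r expr1 mulN1r mulrN.
by congr (M _ _ * M _ _ - M _ _ * M _ _); apply: val_inj.
Qed.

Lemma ord2_cases (i : 'I_2) : i = 0 \/ i = 1.
Proof. by case: i => [[|[|]]] // ?; [left|right]; apply: val_inj. Qed.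

Lemma metricE (R : realType) (p q : 'rV[R]_2) (i j : 'I_2) :
  metric p q i j = (i == j)%:R + p 0 i * p 0 j + q 0 i * q 0 j.
Proof. by rewrite /metric !mxE !big_ord1 !mxE. Qed.

Lemma metricC (R : realType) (p q : 'rV[R]_2) : metric p q = metric q p.
Proof. by rewrite /metric addrAC. Qed.

Lemma det_metric (R : realType) (p q : 'rV[R]_2) :
  \det (metric p q) = (1 + p 0 0 ^+ 2 + q 0 0 ^+ 2) *
    (1 + p 0 1 ^+ 2 + q 0 1 ^+ 2) - (p 0 0 * p 0 1 + q 0 0 * q 0 1) ^+ 2.
Proof. rewrite det_mx2 !metricE /=; ring. Qed.

(* Lagrange's identity. *)
Lemma det_metric_ge1 (R : realType) (p q : 'rV[R]_2) : 1 <= \det (metric p q).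
Proof.
have -> : \det (metric p q) = 1 + (p 0 0 ^+ 2 + p 0 1 ^+ 2 + q 0 0 ^+ 2 +
    q 0 1 ^+ 2 + (p 0 0 * q 0 1 - p 0 1 * q 0 0) ^+ 2) by rewrite det_metric; ring.
by rewrite lerDl !addr_ge0 // sqr_ge0.
Qed.

(** The numerator is half the derivative of [\det (metric p q)] in [p 0 i]. Subtraction in ['I_2] is
    modulo 2, so [1 - i] is the other index. *)
Lemma derive_energy_density_left (R : realType) (p q : 'rV[R]_2) (b : R) (i : 'I_2) :
  'D_(delta_mx 0 i) (fun p' : 'rV[R]_2 => energy_density p' q b) p =
  (p 0 i * (1 + p 0 (1 - i) ^+ 2 + q 0 (1 - i) ^+ 2) -
   p 0 (1 - i) * (p 0 0 * p 0 1 + q 0 0 * q 0 1)) / energy_DBI p q b.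
Proof.
rewrite derive_line /energy_density /energy_DBI.
set B := (X in X / _).
have Dgt0 : 0 < \det (metric p q) + b ^+ 2.
  by rewrite ltr_pwDl ?sqr_ge0 // (lt_le_trans ltr01) // det_metric_ge1.
(* [C] is the coefficient of [h ^+ 2] in the determinant after [p 0 i] is moved by [h]: the
   contribution of [p 0 (1 - i) ^+ 2] cancels against the square of the off-diagonal entry. The
   linear coefficient is [2 * B]. *)
pose C := 1 + q 0 (1 - i) ^+ 2.
transitivity (derive1 (fun h : R =>
    Num.sqrt (\det (metric p q) + b ^+ 2 + (2 * B) * h + C * h ^+ 2) - 1) 0).
  congr (derive1 _ 0); apply/funext => h; congr (Num.sqrt _ - 1).
  rewrite /B /C !det_metric !mxE.
  case: (ord2_cases i) => -> /=.
    have -> : 1 - 0 = 1 :> 'I_2 by apply: val_inj. rewrite /=; ring.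
  have -> : 1 - 1 = 0 :> 'I_2 by apply: val_inj. rewrite /=; ring.
rewrite derive1_sqrt_quadratic // invfM mulrA; congr (_ / _).
by rewrite mulrC mulKf // pnatr_eq0.
Qed.

Lemma energy_densityC (R : realType) (p q : 'rV[R]_2) b :
  energy_density p q b = energy_density q p b.
Proof. by rewrite /energy_density /energy_DBI metricC. Qed.

Lemma derive_energy_density_field (R : realType) (p q : 'rV[R]_2) (b : R) :
  derive1 (fun b' : R => energy_density p q b') b = b / energy_DBI p q b.
Proof.
rewrite derive1E derive_line /energy_density /energy_DBI.
have Dgt0 : 0 < \det (metric p q) + b ^+ 2.
  by rewrite ltr_pwDl ?sqr_ge0 // (lt_le_trans ltr01) // det_metric_ge1.
transitivity (derive1 (fun h : R =>
    Num.sqrt (\det (metric p q) + b ^+ 2 + (2 * b) * h + 1 * h ^+ 2) - 1) 0).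
  congr (derive1 _ 0); apply/funext => h; congr (Num.sqrt _ - 1).
  rewrite /GRing.scale /=; ring.
rewrite derive1_sqrt_quadratic // invfM mulrA; congr (_ / _).
by rewrite mulrC mulKf // pnatr_eq0.
Qed.

(** * Metric and stress tensor under the vortex condition *)

Lemma metric_conformal (R : realType) (p q : 'rV[R]_2) (s : bool) :
  p = (-1) ^+ s *: (q *m (eps R)^T) ->
  metric p q = (1 + (q 0 0 ^+ 2 + q 0 1 ^+ 2))%:M.
Proof.
(* Up to sign [p] is [q] turned by a right angle, so [p] and [q] are orthogonal of equal length and
   [p^T *m p + q^T *m q] is the squared length of [q] times the identity. *)
move=> ->; apply/matrixP => i j; rewrite metricE !mxE !big_ord_recl !big_ord0 !mxE.
have -> : lift ord0 ord0 = 1 :> 'I_2 by apply: val_inj.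
by case: s; case: (ord2_cases i) => ->; case: (ord2_cases j) => -> /=;
  rewrite ?mulr1n ?mulr0n ?expr0 ?expr1; ring.
Qed.

Definition conformal_factor (R : realType) (q : 'rV[R]_2) : R :=
  1 + (q 0 0 ^+ 2 + q 0 1 ^+ 2).

Lemma conformal_factor_ge1 (R : realType) (q : 'rV[R]_2) : 1 <= conformal_factor q.
Proof. by rewrite lerDl addr_ge0 // sqr_ge0. Qed.

Lemma energy_DBI_conformal (R : realType) (p q : 'rV[R]_2) (b m : R) :
  metric p q = m%:M -> energy_DBI p q b = Num.sqrt (m ^+ 2 + b ^+ 2).
Proof. by rewrite /energy_DBI => ->; rewrite det_scalar. Qed.

Lemma det_Mhat_conformal (R : realType) (p q : 'rV[R]_2) (b m : R) :
  metric p q = m%:M -> \det (Mhat p q b) = 1 + b ^+ 2 / m ^+ 2.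
Proof.
rewrite /Mhat => ->; rewrite invmx_scalar mul_mx_scalar det_mx2 !mxE /=.
by rewrite !mulr0n !mulr1n -exprVn; ring.
Qed.

(** With [E] the root, the metric being [m] times the identity turns the scalar terms into
    [m * (m - 1) / E] on the diagonal. Adding [b ^+ 2 / E - (E - 1)] and using
    [E ^+ 2 = m ^+ 2 + b ^+ 2] leaves [1 - m / E]. *)
Lemma stress_density_bps (R : realType) (p q : 'rV[R]_2) (b : R) (s : bool) (i j : 'I_2) :
  p = (-1) ^+ s *: (q *m (eps R)^T) ->
  stress_density p q b i j =
    (i == j)%:R * (1 - conformal_factor q / Num.sqrt (conformal_factor q ^+ 2 + b ^+ 2)).
Proof.
move=> pq; have pqm := metric_conformal pq.
rewrite /stress_density.
(* The energy density is symmetric in the two scalars, so the derivative in [q] is the one in [p]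
   with the arguments exchanged. *)
have -> : (fun q' : 'rV[R]_2 => energy_density p q' b) = (fun q' => energy_density q' p b).
  by apply/funext => q'; rewrite energy_densityC.
rewrite !derive_energy_density_left derive_energy_density_field /energy_density.
have -> : energy_DBI q p b = energy_DBI p q b by rewrite /energy_DBI metricC.
rewrite (energy_DBI_conformal b pqm) -/(conformal_factor q).
set m := conformal_factor q; set E := Num.sqrt _.
have E2 : E ^+ 2 = m ^+ 2 + b ^+ 2 by rewrite sqr_sqrtr // addr_ge0 ?sqr_ge0.
have E0 : E != 0.
  rewrite -sqrf_eq0 E2 gt_eqF // ltr_pwDl ?sqr_ge0 // exprn_gt0 //.
  exact: lt_le_trans (conformal_factor_ge1 q).
have p0 : p 0 0 = (-1) ^+ s * q 0 1.
  rewrite pq !mxE !big_ord_recl big_ord0 !mxE /=; congr (_ * _).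
  have -> : lift ord0 ord0 = 1 :> 'I_2 by apply: val_inj. rewrite /=; ring.
have p1 : p 0 1 = - ((-1) ^+ s * q 0 0).
  rewrite pq !mxE !big_ord_recl big_ord0 !mxE /=.
  have -> : lift ord0 ord0 = 1 :> 'I_2 by apply: val_inj. rewrite /=; ring.
have s2 : ((-1) ^+ s) ^+ 2 = 1 :> R by rewrite sqrr_sign.
(* This is the off-diagonal entry of the metric, which removes the second term of both scalar
   derivatives. *)
have pq0 : p 0 0 * p 0 1 + q 0 0 * q 0 1 = 0.
  rewrite p0 p1; ring: s2.
rewrite pq0 [q 0 0 * _ + _]addrC pq0 !mulr0 !subr0.
have k0 : 1 - 0 = 1 :> 'I_2 by apply: val_inj.
have k1 : 1 - 1 = 0 :> 'I_2 by apply: val_inj.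
have mE : m = 1 + (q 0 0 ^+ 2 + q 0 1 ^+ 2) by [].
case: (ord2_cases i) => ->; case: (ord2_cases j) => ->; rewrite ?k0 ?k1 ?p0 ?p1 mE /= in E2 *.
- by field: E2 s2.
- by field: E2 s2.
- by field: E2 s2.
- by field: E2 s2.
Qed.

(** * Measurability and positive integrals on the plane *)

Definition square (R : realType) (x : R * R) (r : R) : set (R * R) :=
  ball x.1 r `*` ball x.2 r.

Lemma measurable_square (R : realType) (x : R * R) (r : R) : measurable (square x r).
Proof. by apply: measurableX; exact: measurable_ball. Qed.

(** The sigma-algebra of the plane is the product one, so an open set is written as a countable
    union of squares with rational centre and radius. *)
Lemma open_plane_measurable (R : realType) (U : set (R * R)) : open U -> measurable U.
Proof.
move=> oU.
pose F (q : rat * rat * rat) : set (R * R) :=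
  square (ratr q.1.1, ratr q.1.2) (ratr q.2).
(* The union runs over all rational triples, and squares that are not inside [U] are replaced by the
   empty set. *)
have -> : U = \bigcup_q (if `[< F q `<=` U >] then F q else set0).
  apply/seteqP; split => [x Ux|x [q _]]; last by case: asboolP => // FU /FU.
  have /nbhs_ballP[e /= e0 xeU] : nbhs x U by move: oU; rewrite openE; exact.
  (* A radius below [e / 2] and a centre within that radius of [x] keep the whole square within
     distance [e] of [x]. *)
  have e20 : 0 < e / 2 by rewrite divr_gt0.
  have [r /[!in_itv]/= /andP[r0 re]] := rat_in_itvoo e20.
  have xr1 : x.1 - ratr r < x.1 by rewrite ltrBlDr ltrDl.
  have xr2 : x.2 - ratr r < x.2 by rewrite ltrBlDr ltrDl.
  have [a /[!in_itv]/= /andP[a1 a2]] := rat_in_itvoo xr1.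
  have [b /[!in_itv]/= /andP[b1 b2]] := rat_in_itvoo xr2.
  have Fx : F ((a, b), r) x.
    by split; rewrite /ball /= ler0_norm; lra.
  exists ((a, b), r) => //; case: asboolP => // /(_ _)[] y [ya yb].
  apply: xeU; rewrite /ball /= /prod_ball /=; move: Fx ya yb => [].
  rewrite /F/square/ball /= => xa xb ya yb; split.
    rewrite (le_lt_trans (ler_distD (ratr a) _ _)) // [e]splitr ltrD //.
      by rewrite distrC (lt_trans xa).
    by rewrite (lt_trans ya).
  rewrite (le_lt_trans (ler_distD (ratr b) _ _)) // [e]splitr ltrD //.
    by rewrite distrC (lt_trans xb).
  by rewrite (lt_trans yb).
apply: countable_bigcupT_measurable => [|q]; first exact: countableP.
by case: asboolP => // _; exact: measurable_square.
Qed.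

Lemma continuous_plane_measurable (R : realType) (U : set (R * R)) (f : R * R -> R) :
  open U -> (forall x, U x -> {for x, continuous f}) -> measurable_fun U f.
Proof.
move=> oU cf mU; apply: (measurability _ (RGenOpens.measurableE R)) => //.
move=> _ [_ [a [b ->] <-]]; apply: open_plane_measurable.
rewrite openE => x [Ux fx]; apply: filterI; first by move: oU; rewrite openE; exact.
by apply: (cf x Ux); apply: open_nbhs_nbhs; split=> //; exact: itv_open.
Qed.

Lemma area_square_gt0 (R : realType) (x : R * R) (r : R) : 0 < r ->
  (0 < area R (square x r))%E.
Proof.
move=> r0; rewrite product_measure1E; try exact: measurable_ball.
by rewrite /= !lebesgue_measure_ball ?ltW // -EFinM lte_fin mulr_gt0 // pmulrn_lgt0.
Qed.

(** By continuity [f] exceeds [f x / 2] on a square around [x], which has positive area; the rest of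
    [U] contributes a nonnegative amount. *)
Lemma integral_continuous_gt0 (R : realType) (U : set (R * R)) (f : R * R -> R) (x : R * R) :
  open U -> (forall y, U y -> {for y, continuous f}) ->
  (forall y, U y -> 0 <= f y) -> U x -> 0 < f x ->
  (0 < \int[area R]_(y in U) (f y)%:E)%E.
Proof.
move=> oU cf f0 Ux fx0.
have fx2 : f x / 2 < f x by rewrite ltr_pdivrMr // ltr_pMr // ltr1n.
have : nbhs x (U `&` [set y | f x / 2 < f y]).
  apply: filterI; first by move: oU; rewrite openE; exact.
  exact: (cvgr_gt (f x) (cf x Ux) _ fx2).
move=> /nbhs_ballP[e /= e0 eU].
have sU : square x e `<=` U `&` [set y | f x / 2 < f y].
  by move=> y [y1 y2]; exact: eU.
have mf : measurable_fun U (fun y => (f y)%:E).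
  by apply/measurable_EFinP; exact: continuous_plane_measurable.
have mU := open_plane_measurable oU.
have mS := measurable_square x e.
apply: (@lt_le_trans _ _ (\int[area R]_(y in square x e) (f x / 2)%:E)%E).
  by rewrite integral_cst // mule_gt0 ?area_square_gt0 // lte_fin divr_gt0.
apply: (@le_trans _ _ (\int[area R]_(y in square x e) (f y)%:E)%E).
  apply: ge0_le_integral => //.
  - by move=> y _; rewrite lee_fin divr_ge0 // ltW.
  - by apply: measurable_funS mf => // y /sU[].
  - by move=> y /sU[_ /ltW]; rewrite lee_fin.
apply: ge0_subset_integral => //; by move=> y /sU[].
Qed.

(** * Change of variables under dilations *)

Lemma exists_pushforward_measure (d1 d2 : measure_display) (S : measurableType d1)
    (T : measurableType d2) (R : realType) (mu : {measure set S -> \bar R}) (phi : S -> T) :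
  measurable_fun setT phi ->
  exists nu : {measure set T -> \bar R}, nu = pushforward mu phi :> (set T -> \bar R).
Proof. by move=> mphi; unshelve (eexists; reflexivity). Qed.

Lemma lebesgue_measure_dilation (R : realType) (l : R) (A : set R) : 0 < l ->
  measurable A ->
  lebesgue_measure (( *%R l) @^-1` A) = (l^-1%:E * lebesgue_measure A)%E.
Proof.
move=> l0 mA.
have ml : measurable_fun setT ( *%R l : R -> R) by exact: mulrl_measurable.
(* [nu] carries the measure structure on the pushforward, so that it can be rescaled and compared
   with Lebesgue measure by uniqueness. Scaled by [l], it gives []a, b]] the same length as Lebesgue
   measure. *)
have [nu nuE] := @exists_pushforward_measure _ _ (measurableTypeR R) (measurableTypeR R) R
  lebesgue_measure _ ml.
have -> : lebesgue_measure A = mscale (NngNum (ltW l0)) nu A.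
  pose dil : {measure set (measurableTypeR R) -> \bar R} := mscale (NngNum (ltW l0)) nu.
  apply: (@lebesgue_measure_unique R dil _ A mA) => _ [[a b] _ <-] /=.
  rewrite /mscale nuE /pushforward /=.
  have -> : *%R l @^-1` `]a, b] = `]a / l, b / l]%classic.
    by apply/seteqP; split => y /=; rewrite !in_itv /= ltr_pdivrMr // ler_pdivlMr // mulrC.
  rewrite !lebesgue_measure_itv /= !lte_fin ltr_pM2r ?invr_gt0 //.
  case: ifPn => _; last by rewrite mule0.
  by rewrite -!EFinB -EFinM -mulrBl mulrC divfK // gt_eqF.
by rewrite /mscale nuE muleA -EFinM mulVf ?gt_eqF // mul1e.
Qed.

Definition dilate (R : realType) (l : R) (x : R * R) : R * R := (l * x.1, l * x.2).

Lemma measurable_dilate (R : realType) (l : R) : measurable_fun setT (dilate l).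
Proof. by apply: measurable_fun_pair; apply: (measurableT_comp (mulrl_measurable l)). Qed.

(** The integral on the left is one against the pushforward of the area, and this pushforward is
    [l ^- 2] times the area. *)
Lemma integral_dilation (R : realType) (l : R) (U : set (R * R)) (f : R * R -> \bar R) :
  0 < l -> measurable U -> measurable_fun U f -> (forall x, U x -> 0 <= f x)%E ->
  (\int[area R]_(x in dilate l @^-1` U) (f \o dilate l) x =
   (l ^- 2)%:E * \int[area R]_(x in U) f x)%E.
Proof.
move=> l0 mU mf f0.
have mphi := measurable_dilate l.
have fin0 : {in U, forall y, (0 <= f y)%E} by move=> y /set_mem; exact: f0.
pose P : measurableType _ := (measurableTypeR R * measurableTypeR R)%type.
pose mu : {measure set P -> \bar R} := area R.
rewrite -(@ge0_integral_pushforward _ _ P P R (dilate l) mphi mu U f mU mf fin0).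
have l20 : 0 <= l ^- 2 by rewrite invr_ge0 exprn_ge0 // ltW.
rewrite -(@ge0_integral_mscale _ P R mu U mU (NngNum l20) f mf f0).
have [nu nuE] := @exists_pushforward_measure _ _ P P R mu (dilate l) mphi.
have l2 : 0 <= l ^+ 2 by rewrite exprn_ge0 // ltW.
apply: eq_measure_integral => A mA _.
pose sc : {measure set P -> \bar R} := mscale (NngNum l2) nu.
(* [sc] agrees with the area on rectangles, each side contributing a factor [l^-1], hence everywhere
   by uniqueness of the product measure. The two scalings then cancel. *)
transitivity (mscale (NngNum l20) sc A); last first.
  congr (_ * _)%E; apply/esym; apply: (@product_measure_unique _ _ _ _ R _ _ sc) => // B C mB mC.
  rewrite /sc /= /mscale nuE /pushforward.
  have -> : dilate l @^-1` (B `*` C) = (( *%R l) @^-1` B) `*` (( *%R l) @^-1` C) by [].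
  have mdil D : measurable D -> measurable (( *%R l : R -> R) @^-1` D).
    by move=> mD; rewrite -[X in measurable X]setTI; exact: mulrl_measurable.
  have prodE := @product_measure1E _ _ (measurableTypeR R) (measurableTypeR R) R
    lebesgue_measure lebesgue_measure _ _ (mdil _ mB) (mdil _ mC).
  transitivity ((l ^+ 2)%:E * (lebesgue_measure (( *%R l : R -> R) @^-1` B) *
      lebesgue_measure (( *%R l : R -> R) @^-1` C)))%E; first by congr (_ * _)%E; exact: prodE.
  have lE : ((l ^+ 2)%:E * (l^-1%:E * l^-1%:E) = 1 :> \bar R)%E.
    by rewrite -!EFinM -expr2 exprVn mulfV // gt_eqF // exprn_gt0.
  rewrite !lebesgue_measure_dilation // muleACA.
  apply: etrans (muleA _ _ _) _; apply: etrans (mul1e _).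
  by congr (_ * _)%E; exact: lE.
have lE : ((l ^- 2)%:E * (l ^+ 2)%:E = 1 :> \bar R)%E.
  by rewrite -EFinM mulVf // gt_eqF // exprn_gt0.
rewrite /sc /= /mscale nuE /=; apply/esym.
apply: etrans (muleA _ _ _) _; apply: etrans (mul1e _).
by rewrite -nuE; congr (_ * _)%E; exact: lE.
Qed.

(** * Pointwise inequalities for the rescaled density *)

(* The energy density at the dilated point of a configuration dilated by l,
   divided by l^2, with mu = l^-2 and m = 1 + |dY|^2. *)
Definition scaled_density (R : realType) (m b mu : R) : R :=
  Num.sqrt ((mu - 1 + m) ^+ 2 + b ^+ 2) - mu.

Lemma scaled_density_ge0 (R : realType) (m b mu : R) :
  1 <= m -> 0 <= mu -> 0 <= scaled_density m b mu.
Proof.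
move=> m1 mu0; rewrite subr_ge0 -[leLHS](ger0_norm mu0) -sqrtr_sqr ler_wsqrtr //.
nra.
Qed.

Lemma le_sqrt_sqrD (R : realType) (x y : R) : x <= Num.sqrt (x ^+ 2 + y ^+ 2).
Proof. by rewrite (le_trans (ler_norm x)) // -sqrtr_sqr ler_wsqrtr // lerDl sqr_ge0. Qed.

Lemma lt_sqrt_sqrD (R : realType) (x y : R) : y != 0 -> x < Num.sqrt (x ^+ 2 + y ^+ 2).
Proof.
move=> y0; have y2 : 0 < y ^+ 2 by rewrite exprn_even_gt0.
by rewrite (le_lt_trans (ler_norm x)) // -sqrtr_sqr ltr_sqrt ?ltrDl // ltr_wpDl ?sqr_ge0.
Qed.

Lemma sqrtr_le (R : realType) (x y : R) : 0 <= y -> x <= y ^+ 2 -> Num.sqrt x <= y.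
Proof. by move=> y0 xy; rewrite -[leRHS](ger0_norm y0) -sqrtr_sqr ler_wsqrtr. Qed.

Lemma sqrtr_lt (R : realType) (x y : R) : 0 < y -> x < y ^+ 2 -> Num.sqrt x < y.
Proof.
by move=> y0 xy; rewrite -[ltRHS](gtr0_norm y0) -sqrtr_sqr ltr_sqrt // exprn_gt0.
Qed.

(* Once squared, the claim is [m <= Num.sqrt (m ^+ 2 + b ^+ 2)]. *)
Lemma scaled_density_le (R : realType) (m b mu : R) :
  1 <= m -> 1 < mu -> scaled_density m b mu <= scaled_density m b 1.
Proof.
move=> m1 mu1; rewrite /scaled_density subrr add0r.
have := le_sqrt_sqrD m b.
have : Num.sqrt (m ^+ 2 + b ^+ 2) ^+ 2 = m ^+ 2 + b ^+ 2.
  by rewrite sqr_sqrtr // addr_ge0 ?sqr_ge0.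
set E := Num.sqrt (m ^+ 2 + b ^+ 2) => E2 mE.
suff : Num.sqrt ((mu - 1 + m) ^+ 2 + b ^+ 2) <= E + (mu - 1) by lra.
by apply: sqrtr_le; nra.
Qed.

Lemma scaled_density_lt (R : realType) (m b mu : R) :
  1 <= m -> 1 < mu -> b != 0 -> scaled_density m b mu < scaled_density m b 1.
Proof.
move=> m1 mu1 b0; rewrite /scaled_density subrr add0r.
have := lt_sqrt_sqrD m b0.
have : Num.sqrt (m ^+ 2 + b ^+ 2) ^+ 2 = m ^+ 2 + b ^+ 2.
  by rewrite sqr_sqrtr // addr_ge0 ?sqr_ge0.
set E := Num.sqrt (m ^+ 2 + b ^+ 2) => E2 mE.
suff : Num.sqrt ((mu - 1 + m) ^+ 2 + b ^+ 2) < E + (mu - 1) by lra.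
by apply: sqrtr_lt; nra.
Qed.

(** With [E] the root, the middle term is [(E - m) / E]. As [1 <= m <= E], it is at most [E - 1],
    the energy density; this domination later gives integrability of the stress. *)
Lemma conformal_stress_bounds (R : realType) (m b : R) : 1 <= m ->
  0 <= 1 - m / Num.sqrt (m ^+ 2 + b ^+ 2) <= scaled_density m b 1.
Proof.
move=> m1; rewrite /scaled_density subrr add0r.
have := le_sqrt_sqrD m b; set E := Num.sqrt _ => mE.
have E0 : 0 < E by lra.
have -> : 1 - m / E = (E - m) / E by field; rewrite gt_eqF.
rewrite divr_ge0 ?subr_ge0 ?(ltW E0) //= ler_pdivrMr //; nra.
Qed.

Lemma conformal_stress_gt0 (R : realType) (m b : R) : 1 <= m -> b != 0 ->
  0 < 1 - m / Num.sqrt (m ^+ 2 + b ^+ 2).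
Proof.
move=> m1 b0; have mE := lt_sqrt_sqrD m b0.
by rewrite subr_gt0 ltr_pdivrMr ?mul1r //; lra.
Qed.

(** * Scalar deformations as dilations *)

Lemma linear_map_scalar (R : realType) (l : R) :
  linear_map (l - 1)%:M = dilate l.
Proof.
apply/funext => x; rewrite /linear_map /dilate !mxE /= !mulr1n !mulr0n.
by congr pair; ring.
Qed.

Lemma partial_dilate (R : realType) (l : R) (f : R * R -> R) (x : R * R) (i : 'I_2) :
  differentiable f (dilate l x) ->
  partial i (f \o dilate l) x = l * partial i f (dilate l x).
Proof.
move=> df; rewrite /partial; set v := basis_vec R i.
(* Dilating the line through [x] in direction [v] gives the line through the dilated point in
   direction [l *: v]; differentiability then makes the derivative linear in the direction. *)
transitivity ('D_(l *: v) f (dilate l x)).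
  rewrite !derive_line; congr (derive1 _ 0); apply/funext => h /=.
  by congr f; rewrite /dilate; congr pair; rewrite mulrDr mulrCA.
by rewrite !deriveE // linearZ.
Qed.

(** * Energy and stress of a vortex configuration and of its dilations *)

Section BpsVortex.
Context (R : realType) (sgn : bool) (c : configuration R).
Hypotheses (regc : regular_fields c) (bpsc : bps_vortex sgn c).

Let D := ~` cores c.
Let m (x : R * R) : R := conformal_factor (grad (scalarY c) x).
Let b := fieldB c.

Let oD : open D. Proof. by case: regc => -[clc _] _ _ _; exact: closed_openC. Qed.

Let m1 x : 1 <= m x. Proof. exact: conformal_factor_ge1. Qed.

Let m_continuous x : D x -> {for x, continuous m}.
Proof.
move=> Dx; case: regc => _ _ cp _.
have -> : m = fun x => 1 + (partial 0 (scalarY c) x ^+ 2 + partial 1 (scalarY c) x ^+ 2).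
  by apply/funext => y; rewrite /m /conformal_factor !mxE.
apply: cvgD; first exact: cvg_cst.
by apply: cvgD; apply: (cvgM (proj2 (cp _ x Dx)) (proj2 (cp _ x Dx))).
Qed.

Let b_continuous x : D x -> {for x, continuous b}.
Proof. by case: regc => _ _ _; exact. Qed.

Lemma bps_vortex_grad x : D x ->
  grad (scalarX c) x = (-1) ^+ sgn *: (grad (scalarY c) x *m (eps R)^T).
Proof.
move=> Dx; apply/rowP => i; rewrite !mxE bpsc //; congr (_ * _).
by apply: eq_bigr => j _; rewrite !mxE mulrC.
Qed.

Lemma config_density_bps x : D x -> config_density c x = scaled_density (m x) (b x) 1.
Proof.
move=> Dx; rewrite /config_density /energy_density.
rewrite (energy_DBI_conformal _ (metric_conformal (bps_vortex_grad Dx))).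
by rewrite /scaled_density subrr add0r.
Qed.

Lemma stress_bps x i j : D x ->
  stress c x i j = (i == j)%:R * (1 - m x / Num.sqrt (m x ^+ 2 + b x ^+ 2)).
Proof. by move=> Dx; rewrite /stress (stress_density_bps _ _ _ (bps_vortex_grad Dx)). Qed.

Lemma det_config_Mhat_bps x : D x -> \det (config_Mhat c x) = 1 + b x ^+ 2 / m x ^+ 2.
Proof.
by move=> Dx; rewrite /config_Mhat (det_Mhat_conformal _ (metric_conformal (bps_vortex_grad Dx))).
Qed.

(** The gradients pick up a factor [l] and the magnetic field the Jacobian [l ^+ 2], so [l ^+ 2] can
    be taken out of the root. *)
Lemma deform_density (l : R) x : 0 < l -> D (dilate l x) ->
  config_density (deform (l - 1)%:M c) x =
  l ^+ 2 * scaled_density (m (dilate l x)) (b (dilate l x)) (l ^- 2).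
Proof.
move=> l0 Dx; rewrite /config_density /deform /= linear_map_scalar.
case: regc => _ /(_ _ Dx)[dX dY] _ _.
have gradE f : differentiable f (dilate l x) ->
    grad (f \o dilate l) x = l *: grad f (dilate l x).
  by move=> df; apply/rowP => i; rewrite !mxE partial_dilate.
rewrite !gradE //.
have bps' := bps_vortex_grad Dx.
(* The vortex condition is linear in the gradients, so it survives the dilation and the deformed
   metric is again conformal. *)
rewrite /energy_density (energy_DBI_conformal _ (metric_conformal (s := sgn) _)); last first.
  by rewrite bps' -scalemxAl !scalerA mulrC.
have -> : \det (1%:M + (l - 1)%:M : 'M[R]_2) = l ^+ 2.
  by rewrite det_mx2 !mxE /= !mulr1n !mulr0n; ring.
rewrite /scaled_density /m /conformal_factor !mxE -/b.
set u := partial _ _ _; set v := partial _ _ _.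
have l20 : 0 <= l ^+ 2 by rewrite exprn_ge0 // ltW.
have ln0 : l != 0 by rewrite gt_eqF.
rewrite mulrBr mulfV ?expf_neq0 //; congr (_ - 1).
rewrite -[X in _ = X * _](ger0_norm l20) -sqrtr_sqr -sqrtrM ?sqr_ge0 //.
by congr Num.sqrt; field.
Qed.

Let scaled_density_continuous mu x : D x ->
  {for x, continuous (fun y => scaled_density (m y) (b y) mu)}.
Proof.
move=> Dx; have cm := m_continuous Dx; have cb := b_continuous Dx.
apply: cvgB; last exact: cvg_cst.
apply: continuous_cvg; first exact: sqrt_continuous.
apply: cvgD; last exact: cvgM.
by apply: cvgM; apply: cvgD => //; exact: cvg_cst.
Qed.

Let stress_continuous x : D x ->
  {for x, continuous (fun y => 1 - m y / Num.sqrt (m y ^+ 2 + b y ^+ 2))}.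
Proof.
move=> Dx; have cm := m_continuous Dx; have cb := b_continuous Dx.
apply: cvgB; first exact: cvg_cst.
apply: cvgM => //; apply: cvgV.
  rewrite gt_eqF // sqrtr_gt0 ltr_pwDl ?sqr_ge0 // exprn_gt0 //.
  exact: lt_le_trans ltr01 (m1 x).
apply: continuous_cvg; first exact: sqrt_continuous.
by apply: cvgD; exact: cvgM.
Qed.

Lemma energy_bps : energy c = (\int[area R]_(x in D) (scaled_density (m x) (b x) 1)%:E)%E.
Proof. by apply: eq_integral => x /set_mem Dx; rewrite config_density_bps. Qed.

Let measurable_density mu :
  measurable_fun D (fun x => (scaled_density (m x) (b x) mu)%:E).
Proof.
apply/measurable_EFinP; apply: continuous_plane_measurable => // x.
exact: scaled_density_continuous.
Qed.

(** The factor [l ^+ 2] of [deform_density] cancels the [l ^- 2] of the change of variables, so both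
    energies become integrals over the same set [D]. *)
Lemma energy_deform_bps (l : R) : 0 < l ->
  energy (deform (l - 1)%:M c) =
  (\int[area R]_(x in D) (scaled_density (m x) (b x) (l ^- 2))%:E)%E.
Proof.
move=> l0.
have l20 : 0 <= l ^- 2 by rewrite invr_ge0 exprn_ge0 // ltW.
have l2 : 0 <= l ^+ 2 by rewrite exprn_ge0 // ltW.
have mD := open_plane_measurable oD.
have md := measurable_density (l ^- 2).
transitivity (\int[area R]_(x in dilate l @^-1` D)
    ((fun y => ((l ^+ 2)%:E * (scaled_density (m y) (b y) (l ^- 2))%:E)%E) \o dilate l) x)%E.
  rewrite /energy /= linear_map_scalar; apply: eq_integral => x /set_mem Dx.
  by rewrite deform_density.
rewrite integral_dilation //; last 2 first.
- exact: measurable_funeM.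
- by move=> x _; rewrite mule_ge0 // lee_fin // scaled_density_ge0.
rewrite ge0_integralZl_EFin //; last by move=> x _; rewrite lee_fin scaled_density_ge0.
by rewrite muleA -EFinM mulVf ?mul1e // expf_neq0 // gt_eqF.
Qed.

(** The diagonal stress lies between 0 and the energy density, which is nonnegative with finite
    integral. *)
Lemma bps_vortex_stress_integrable (i : 'I_2) : (energy c < +oo)%E ->
  (area R).-integrable D (fun x => (stress c x i i)%:E).
Proof.
move=> fin; have mD := open_plane_measurable oD.
have int1 : (area R).-integrable D (fun x => (scaled_density (m x) (b x) 1)%:E).
  have abs_fin : (\int[area R]_(x in D) `|(scaled_density (m x) (b x) 1)%:E| < +oo)%E.
    apply: le_lt_trans fin; rewrite energy_bps le_eqVlt; apply/orP; left; apply/eqP.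
    by apply: eq_integral => x _; rewrite gee0_abs // lee_fin scaled_density_ge0.
  by apply/integrableP; split; [exact: measurable_density|exact: abs_fin].
apply: le_integrable int1 => //.
  apply: (@eq_measurable_fun _ _ _ _ _ (fun y => (1 - m y / Num.sqrt (m y ^+ 2 + b y ^+ 2))%:E)).
    by move=> x /set_mem Dx; rewrite stress_bps // eqxx mul1r.
  by apply/measurable_EFinP; exact: continuous_plane_measurable.
move=> x Dx; rewrite stress_bps // eqxx mul1r lee_fin.
have /andP[s0 s1] := conformal_stress_bounds (b x) (m1 x).
by rewrite !ger0_norm // scaled_density_ge0.
Qed.

Lemma bps_vortex_stress_integral_gt0 (i : 'I_2) : has_magnetic_field c ->
  (0 < \int[area R]_(x in D) (stress c x i i)%:E)%E.
Proof.
move=> [x [Dx /eqP bx]].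
suff : (0 < \int[area R]_(y in D) (1 - m y / Num.sqrt (m y ^+ 2 + b y ^+ 2))%:E)%E.
  congr (_ < _)%E; apply: eq_integral => y /set_mem Dy.
  by rewrite stress_bps // eqxx mul1r.
apply: (@integral_continuous_gt0 _ _ _ x) => //.
- by move=> y Dy; have /andP[] := conformal_stress_bounds (b y) (m1 y).
- exact: conformal_stress_gt0.
Qed.

Lemma energy_deform_lt (l : R) : (energy c < +oo)%E -> has_magnetic_field c ->
  0 < l < 1 -> (energy (deform (l - 1)%:M c) < energy c)%E.
Proof.
move=> fin [x [Dx /eqP bx]] /andP[l0 l1].
have mu1 : 1 < l ^- 2 by rewrite invf_gt1 ?exprn_gt0 // exprn_ilt1 // ltW.
have mD := open_plane_measurable oD.
rewrite energy_deform_bps // energy_bps.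
set mu := l ^- 2 in mu1 *.
pose gap y := scaled_density (m y) (b y) 1 - scaled_density (m y) (b y) mu.
have gap0 y : 0 <= gap y by rewrite subr_ge0 scaled_density_le.
have cgap y : D y -> {for y, continuous gap}.
  by move=> Dy; apply: cvgB; exact: scaled_density_continuous.
have gap_gt0 : (0 < \int[area R]_(y in D) (gap y)%:E)%E.
  by apply: (@integral_continuous_gt0 _ _ _ x) => //; rewrite subr_gt0 scaled_density_lt.
have mgap : measurable_fun D (fun y => (gap y)%:E).
  by apply/measurable_EFinP; exact: continuous_plane_measurable.
have mu0 : 0 <= mu by rewrite ltW // (lt_trans ltr01).
(* The difference of the two energies is the integral of [gap], which is continuous, nonnegative and
   positive where the magnetic field is nonzero. *)
have splitE : (\int[area R]_(y in D) (scaled_density (m y) (b y) 1)%:E =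
    \int[area R]_(y in D) (scaled_density (m y) (b y) mu)%:E +
    \int[area R]_(y in D) (gap y)%:E)%E.
  rewrite -ge0_integralD //.
  - by apply: eq_integral => y _; rewrite -EFinD /gap addrC subrK.
  - by move=> y _; rewrite lee_fin scaled_density_ge0.
  - exact: measurable_density.
  - by move=> y _; rewrite lee_fin.
(* Adding a positive amount is a strict increase only from a finite value: the dilated energy is
   finite because it is at most [energy c]. *)
rewrite splitE lteDl // ge0_fin_numE.
  apply: le_lt_trans fin; rewrite energy_bps splitE.
  by rewrite leeDl // ltW.
by apply: integral_ge0 => y _; rewrite lee_fin scaled_density_ge0.
Qed.

End BpsVortex.

(** * Stress formula and exclusion of vortices with a magnetic field *)

Theorem mainTheorem4 (R : realType) (sgn : bool) (c : configuration R) :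
  finite_energy_configuration c ->
  bps_vortex sgn c ->
  [/\ forall x, ~ cores c x ->
        \det (config_Mhat c x) =
          1 + fieldB c x ^+ 2 /
              (1 + \sum_(i < 2) partial i (scalarY c) x ^+ 2) ^+ 2 /\
        (forall i j : 'I_2,
           stress c x i j =
             (i == j)%:R * ((Num.sqrt (\det (config_Mhat c x)) - 1) /
                            Num.sqrt (\det (config_Mhat c x)))),
      ~ has_magnetic_field c ->
        forall x, ~ cores c x -> forall i j : 'I_2, stress c x i j = 0,
      has_magnetic_field c ->
        (forall x, ~ cores c x -> forall i j : 'I_2, 0 <= stress c x i j) /\
        (forall i : 'I_2,
           (area R).-integrable (~` cores c)
             (fun x => (stress c x i i)%:E) /\
           (\int[area R]_(x in ~` cores c) (stress c x i i)%:E <> 0)%E)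
    & has_magnetic_field c -> ~ deformation_constraint c /\ ~ soliton c].
Proof.
move=> [regc fin _] bps.
have Dm x : ~ cores c x -> 1 + \sum_(i < 2) partial i (scalarY c) x ^+ 2 =
    conformal_factor (grad (scalarY c) x).
  move=> _; rewrite /conformal_factor !mxE !big_ord_recl big_ord0 addr0.
  by congr (1 + (_ + partial _ _ _ ^+ 2)); apply: val_inj.
have stress0 x i j : ~ cores c x -> 0 <= stress c x i j.
  move=> Dx; rewrite (stress_bps bps) // mulr_ge0 //.
  by have /andP[] := conformal_stress_bounds (fieldB c x)
    (conformal_factor_ge1 (grad (scalarY c) x)).
have int_neq0 i : has_magnetic_field c ->
    (\int[area R]_(x in ~` cores c) (stress c x i i)%:E <> 0)%E.
  by move=> hB; apply/eqP; rewrite gt_eqF // (bps_vortex_stress_integral_gt0 regc bps).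
split.
- move=> x Dx; rewrite Dm // (det_config_Mhat_bps bps) //; split => // i j.
  rewrite (stress_bps bps) //; congr (_ * _).
  set m := conformal_factor _; set b := fieldB c x.
  have m0 : 0 < m by rewrite (lt_le_trans ltr01) // conformal_factor_ge1.
  (* The root of the determinant is thus [Num.sqrt (m ^+ 2 + b ^+ 2) / m], whose inverse is the
     ratio in [stress_bps]. *)
  have -> : 1 + b ^+ 2 / m ^+ 2 = (m ^+ 2 + b ^+ 2) / m ^+ 2.
    by rewrite mulrDl mulfV // expf_neq0 // gt_eqF.
  rewrite sqrtrM ?addr_ge0 ?sqr_ge0 // sqrtrV ?sqr_ge0 // sqrtr_sqr gtr0_norm //.
  have E0 : Num.sqrt (m ^+ 2 + b ^+ 2) != 0.
    by rewrite gt_eqF // sqrtr_gt0 ltr_pwDl ?sqr_ge0 // exprn_gt0.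
  by field; rewrite E0 gt_eqF.
- move=> nB x Dx i j; rewrite (stress_bps bps) //.
  have -> : fieldB c x = 0 by apply: contrapT => bx; apply: nB; exists x.
  have m0 : 0 < conformal_factor (grad (scalarY c) x).
    by rewrite (lt_le_trans ltr01) // conformal_factor_ge1.
  have mn0 : conformal_factor (grad (scalarY c) x) != 0 by rewrite gt_eqF.
  by rewrite expr0n addr0 sqrtr_sqr gtr0_norm // divff // subrr mulr0.
- move=> hB; split => [x Dx i j|i]; first exact: stress0.
  by split; [exact: (bps_vortex_stress_integrable regc bps)|exact: int_neq0].
- move=> hB; split; first by move=> /(_ 0 0); exact: int_neq0.
  move=> [_ minc].
  (* Minimality near the zero matrix is restricted to scalar matrices [t%:M] with [t] tending to 0
     from below, which are the dilations by [l = t + 1 < 1]. *)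
  have cvg_scalar : (t%:M : 'M[R]_2) @[t --> (0 : R)^'-] --> (0 : 'M[R]_2).
    apply: cvg_at_left_filter.
    have : t *: (1%:M : 'M[R]_2) @[t --> (0 : R)] --> 0 *: (1%:M : 'M[R]_2).
      exact: scalel_continuous.
    by rewrite scale0r; under eq_fun do rewrite scalemx1.
  have near0 : \forall t \near (0 : R)^'-, (energy c <= energy (deform t%:M c))%E.
    exact: cvg_scalar minc.
  near (0 : R)^'- => t.
  have t0 : t < 0 by near: t; exact: nbhs_left_lt.
  (* This keeps the dilation factor [t + 1] positive, as [energy_deform_lt] requires. *)
  have t1 : -1 < t by near: t; apply: nbhs_left_gt; rewrite ltrN10.
  have t01 : 0 < t + 1 < 1 by apply/andP; split; lra.
  have := energy_deform_lt regc bps fin hB t01.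
  by rewrite addrK ltNge => /negP; apply; near: t.
Unshelve. all: by end_near. Qed.
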